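(* Let $K_1,K_2$ be oriented knots in $\mathbb{S}^3$ and let $\rho:\pi_1(K_1\#K_2)\to \mathrm{PSL}(2,\mathbb{C})$ be a boundary-parabolic representation. Then there exist boundary-parabolic representations $\rho_1:\pi_1(K_1)\to \mathrm{PSL}(2,\mathbb{C})$ and $\rho_2:\pi_1(K_2)\to \mathrm{PSL}(2,\mathbb{C})$, each unique up to conjugation in $\mathrm{PSL}(2,\mathbb{C})$, such that $\rho$ is (up to conjugation) one of the representations obtained from $\rho_1$ and $\rho_2$ by the connected sum construction.
   Context: All representations are considered up to conjugation in $\mathrm{PSL}(2,\mathbb{C})$. For an oriented knot $K\subset\mathbb{S}^3$, $\pi_1(K)$ denotes the knot group $\pi_1(\mathbb{S}^3\setminus K)$. A representation $\rho:\pi_1(K)\to\mathrm{PSL}(2,\mathbb{C})$ is boundary-parabolic if every meridian is sent to a parabolic (in particular non-trivial) element; $\mathcal{P}$ is the set of parabolic elements of $\mathrm{PSL}(2,\mathbb{C})$. Arc-coloring: let $D$ be an oriented diagram of $K$ (with at least one crossing) with arcs $\alpha_1,\dots,\alpha_n$, also viewed as the Wirtinger (meridian) generators of $\pi_1(K)$. Wirtinger relation at a crossing: if $\alpha_k$ is the over-arc, $\alpha_l$ the under-arc lying to the right of the oriented over-arc and $\alpha_{l'}$ the under-arc lying to its left, then $\alpha_{l'}=\alpha_k\alpha_l\alpha_k^{-1}$. A boundary-parabolic $\rho$ is the same thing as the arc-coloring $a_k=\rho(\alpha_k)\in\mathcal{P}$ satisfying these relations at all crossings. Connected sum construction: let $D_1,D_2$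 be oriented diagrams of $K_1,K_2$, and let $D_1\#D_2$ be the diagram of $K_1\#K_2$ formed by cutting an arc $\alpha$ of $D_1$ and an arc $\beta$ of $D_2$ and joining the ends compatibly with the orientations by two connecting arcs. Given boundary-parabolic $\rho_j:\pi_1(K_j)\to\mathrm{PSL}(2,\mathbb{C})$, $j=1,2$, conjugate $\rho_1,\rho_2$ so that $\rho_1(\alpha)=\rho_2(\beta)=:a\in\mathcal{P}$. Color the two connecting arcs of $D_1\#D_2$ by $a$ and let all other arcs keep their colors from $D_1$ and $D_2$. This arc-coloring defines a boundary-parabolic representation of $\pi_1(K_1\#K_2)$. Any representation obtained in this way (for some choice of conjugations with $\rho_1(\alpha)=\rho_2(\beta)$) is called a connected sum $\rho_1\#\rho_2$ of $\rho_1$ and $\rho_2$; it is in general not unique up to conjugation. The decomposition of $K_1\# K_2$ into $K_1$ and $K_2$, i.e. the diagram $D_1\#D_2$, is regarded as fixed. *)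

(* Defs.v *)
From HB Require Import structures.
From mathcomp Require Import all_boot all_order all_algebra perm.
From mathcomp Require Import boolp reals complex.

Set Implicit Arguments.
Unset Strict Implicit.
Unset Printing Implicit Defensive.

Import GRing.Theory.
Local Open Scope ring_scope.
Local Open Scope quotient_scope.
Local Open Scope group_scope.

Definition SL2 (F : fieldType) := {A : 'M[F]_2 | (\det A == 1)%R}.

HB.instance Definition _ (F : fieldType) := Choice.on (SL2 F).

Section SL2Group.
Variable F : fieldType.
Implicit Types A B C : SL2 F.

Fact SL2_one_subproof : (\det (1%:M : 'M[F]_2) == 1)%R.
Proof. by rewrite det1. Qed.

Fact SL2_mul_subproof A B : (\det (val A *m val B) == 1)%R.
Proof. by rewrite det_mulmx (eqP (valP A)) (eqP (valP B)) mulr1. Qed.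

Fact SL2_inv_subproof A : (\det (invmx (val A)) == 1)%R.
Proof. by rewrite det_inv (eqP (valP A)) invr1. Qed.

Definition SL2_one : SL2 F := Sub 1%:M%R SL2_one_subproof.
Definition SL2_mul A B : SL2 F := Sub (val A *m val B) (SL2_mul_subproof A B).
Definition SL2_inv A : SL2 F := Sub (invmx (val A)) (SL2_inv_subproof A).

Fact SL2_unit A : val A \in unitmx.
Proof. by rewrite unitmxE (eqP (valP A)) unitr1. Qed.

Fact SL2_mulA : associative SL2_mul.
Proof. by move=> A B C; apply: val_inj; rewrite !SubK mulmxA. Qed.

Fact SL2_mul1 : left_id SL2_one SL2_mul.
Proof. by move=> A; apply: val_inj; rewrite !SubK mul1mx. Qed.

Fact SL2_mulr1 : right_id SL2_one SL2_mul.
Proof. by move=> A; apply: val_inj; rewrite !SubK mulmx1. Qed.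

Fact SL2_mulV : left_inverse SL2_one SL2_inv SL2_mul.
Proof. by move=> A; apply: val_inj; rewrite !SubK mulVmx ?SL2_unit. Qed.

Fact SL2_mulrV : right_inverse SL2_one SL2_inv SL2_mul.
Proof. by move=> A; apply: val_inj; rewrite !SubK mulmxV ?SL2_unit. Qed.

HB.instance Definition _ :=
  isGroup.Build (SL2 F) SL2_mulA SL2_mul1 SL2_mulr1 SL2_mulV SL2_mulrV.

Definition pm_eq : rel (SL2 F) :=
  fun A B => (val A == val B) || (val A == - val B)%R.

Fact pm_eq_refl : reflexive pm_eq.
Proof. by move=> A; rewrite /pm_eq eqxx. Qed.

Fact pm_eq_sym : symmetric pm_eq.
Proof.
by move=> A B; rewrite /pm_eq eq_sym [(val B == - _)%R]eq_sym eqr_oppLR.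
Qed.

Fact pm_eq_trans : transitive pm_eq.
Proof.
move=> B A C; rewrite /pm_eq.
case/orP=> /eqP-> /orP[] /eqP->; rewrite ?opprK ?eqxx ?orbT //.
Qed.

Canonical pm_eq_equiv := EquivRel pm_eq pm_eq_refl pm_eq_sym pm_eq_trans.

Lemma pm_eqM A A' B B' : pm_eq A A' -> pm_eq B B' -> pm_eq (A * B) (A' * B').
Proof.
rewrite /pm_eq /= => /orP[] /eqP-> /orP[] /eqP->;
  by rewrite ?mulNmx ?mulmxN ?opprK eqxx ?orbT.
Qed.

Lemma pm_eqV A A' : pm_eq A A' -> pm_eq A^-1 A'^-1.
Proof.
rewrite /pm_eq /= => /orP[] /eqP->; first by rewrite eqxx.
rewrite -scaleN1r invmxZ; last first.
  by rewrite unitmxE detZ (eqP (valP A')) mulr1 unitrX ?unitrN1.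
by rewrite invrN invr1 scaleN1r eqxx orbT.
Qed.

Definition PSL2 := {eq_quot pm_eq}.

HB.instance Definition _ := Choice.on PSL2.
HB.instance Definition _ := EqQuotient.on PSL2.

Definition PSL2_mul (g h : PSL2) : PSL2 := \pi_PSL2 (repr g * repr h).
Definition PSL2_inv (g : PSL2) : PSL2 := \pi_PSL2 (repr g)^-1.

Lemma PSL2_piP A B : (\pi_PSL2 A == \pi_PSL2 B) = pm_eq A B.
Proof. exact: eqmodE. Qed.

Lemma PSL2_repr A : pm_eq (repr (\pi_PSL2 A)) A.
Proof. by rewrite -PSL2_piP reprK. Qed.

Lemma PSL2_piM A B : PSL2_mul (\pi_PSL2 A) (\pi_PSL2 B) = \pi_PSL2 (A * B).
Proof. by apply/eqP; rewrite PSL2_piP; apply: pm_eqM; apply: PSL2_repr. Qed.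

Lemma PSL2_piV A : PSL2_inv (\pi_PSL2 A) = \pi_PSL2 A^-1.
Proof. by apply/eqP; rewrite PSL2_piP; apply/pm_eqV/PSL2_repr. Qed.

Fact PSL2_mulA : associative PSL2_mul.
Proof.
move=> g h k; rewrite -[g]reprK -[h]reprK -[k]reprK.
by rewrite (PSL2_piM (repr h)) (PSL2_piM (repr g) (repr h)) !PSL2_piM mulgA.
Qed.

Fact PSL2_mul1 : left_id (\pi_PSL2 1) PSL2_mul.
Proof. by move=> g; rewrite -[g]reprK PSL2_piM mul1g. Qed.

Fact PSL2_mulr1 : right_id (\pi_PSL2 1) PSL2_mul.
Proof. by move=> g; rewrite -[g]reprK PSL2_piM mulg1. Qed.

Fact PSL2_mulV : left_inverse (\pi_PSL2 1) PSL2_inv PSL2_mul.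
Proof. by move=> g; rewrite -[g]reprK PSL2_piV PSL2_piM mulVg. Qed.

Fact PSL2_mulrV : right_inverse (\pi_PSL2 1) PSL2_inv PSL2_mul.
Proof. by move=> g; rewrite -[g]reprK PSL2_piV PSL2_piM mulgV. Qed.

HB.instance Definition _ :=
  isGroup.Build PSL2 PSL2_mulA PSL2_mul1 PSL2_mulr1 PSL2_mulV PSL2_mulrV.

End SL2Group.

(* The trace of an element of PSL(2, F) is defined up to sign, so its square
   does not depend on the representative. *)
Definition parabolic (F : fieldType) (g : PSL2 F) : Prop :=
  g <> 1 /\ (\tr (val (repr g)) ^+ 2 = 4%:R)%R.

(* A letter (x, false) stands for the generator x, and (x, true) for x^-1. *)
Definition word (X : Type) := seq (X * bool).

Definition word_inv (X : Type) (w : word X) : word X :=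
  rev [seq (a.1, ~~ a.2) | a <- w].

Inductive pres_eq (X : Type) (rels : word X -> word X -> Prop) :
    word X -> word X -> Prop :=
  | PresRel u v : rels u v -> pres_eq rels u v
  | PresCancel x b : pres_eq rels [:: (x, b); (x, ~~ b)] [::]
  | PresCat u u' v v' :
      pres_eq rels u u' -> pres_eq rels v v' -> pres_eq rels (u ++ v) (u' ++ v')
  | PresRefl u : pres_eq rels u u
  | PresSym u v : pres_eq rels u v -> pres_eq rels v u
  | PresTrans u v w : pres_eq rels u v -> pres_eq rels v w -> pres_eq rels u w.

Section PresentedGroup.
Variables (X : choiceType) (rels : word X -> word X -> Prop).
Implicit Types u v w : word X.

Definition pres_eqb : rel (word X) := fun u v => `[< pres_eq rels u v >].

Fact pres_eqb_refl : reflexive pres_eqb.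
Proof. by move=> u; apply/asboolP; apply: PresRefl. Qed.

Fact pres_eqb_sym : symmetric pres_eqb.
Proof. by move=> u v; apply/asboolP/asboolP; apply: PresSym. Qed.

Fact pres_eqb_trans : transitive pres_eqb.
Proof. by move=> v u w /asboolP uv /asboolP vw; apply/asboolP/(PresTrans uv). Qed.

Canonical pres_eqb_equiv :=
  EquivRel pres_eqb pres_eqb_refl pres_eqb_sym pres_eqb_trans.

Lemma word_invK : involutive (@word_inv X).
Proof.
move=> u; rewrite /word_inv map_rev revK -map_comp -[RHS]map_id.
by apply: eq_map => -[x b] /=; rewrite negbK.
Qed.

Lemma pres_eq_mulV u : pres_eq rels (u ++ word_inv u) [::].
Proof.
elim: u => [|[x b] u IHu]; first exact: PresRefl.
rewrite /word_inv /= rev_cons -cats1 catA -cat_cons -cat1s -catA.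
apply: (@PresTrans _ _ _ ([:: (x, b)] ++ ([::] ++ [:: (x, ~~ b)]))).
  by apply: PresCat (PresRefl _ _) (PresCat IHu (PresRefl _ _)).
exact: PresCancel.
Qed.

Lemma pres_eq_Vmul u : pres_eq rels (word_inv u ++ u) [::].
Proof. by rewrite -{2}[u]word_invK; apply: pres_eq_mulV. Qed.

Lemma pres_eq_inv u v : pres_eq rels u v -> pres_eq rels (word_inv u) (word_inv v).
Proof.
move=> uv; apply: (@PresTrans _ _ _ (word_inv u ++ (v ++ word_inv v))).
  rewrite -{1}[word_inv u]cats0.
  exact: PresCat (PresRefl _ _) (PresSym (pres_eq_mulV v)).
apply: (@PresTrans _ _ _ ((word_inv u ++ u) ++ word_inv v)).
  rewrite catA; apply: PresCat (PresRefl _ _).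
  exact: PresCat (PresRefl _ _) (PresSym uv).
rewrite -{2}[word_inv v]cat0s.
exact: PresCat (pres_eq_Vmul u) (PresRefl _ _).
Qed.

Definition presented_group := {eq_quot pres_eqb}.

HB.instance Definition _ := Choice.on presented_group.
HB.instance Definition _ := EqQuotient.on presented_group.

Local Notation piG := \pi_presented_group.

Definition pres_mul (g h : presented_group) : presented_group :=
  piG (repr g ++ repr h).
Definition pres_inv (g : presented_group) : presented_group :=
  piG (word_inv (repr g)).

Lemma pres_piP u v : reflect (pres_eq rels u v) (piG u == piG v).
Proof. by rewrite [_ == _]eqmodE; apply: asboolP. Qed.

Lemma pres_repr u : pres_eq rels (repr (piG u)) u.
Proof. by apply/pres_piP; rewrite reprK. Qed.

Lemma pres_piM u v : pres_mul (piG u) (piG v) = piG (u ++ v).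
Proof. by apply/eqP/pres_piP; apply: PresCat; apply: pres_repr. Qed.

Lemma pres_piV u : pres_inv (piG u) = piG (word_inv u).
Proof. by apply/eqP/pres_piP; apply: pres_eq_inv; apply: pres_repr. Qed.

Fact pres_mulA : associative pres_mul.
Proof.
move=> g h k; rewrite -[g]reprK -[h]reprK -[k]reprK.
by rewrite (pres_piM (repr h)) (pres_piM (repr g) (repr h)) !pres_piM catA.
Qed.

Fact pres_mul1 : left_id (piG [::]) pres_mul.
Proof. by move=> g; rewrite -[g]reprK pres_piM. Qed.

Fact pres_mulr1 : right_id (piG [::]) pres_mul.
Proof. by move=> g; rewrite -[g]reprK pres_piM cats0. Qed.

Fact pres_mulV : left_inverse (piG [::]) pres_inv pres_mul.
Proof.
move=> g; rewrite -[g]reprK pres_piV pres_piM.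
by apply/eqP/pres_piP/pres_eq_Vmul.
Qed.

Fact pres_mulrV : right_inverse (piG [::]) pres_inv pres_mul.
Proof.
move=> g; rewrite -[g]reprK pres_piV pres_piM.
by apply/eqP/pres_piP/pres_eq_mulV.
Qed.

HB.instance Definition _ :=
  isGroup.Build presented_group pres_mulA pres_mul1 pres_mulr1
    pres_mulV pres_mulrV.

Definition pres_gen (x : X) : presented_group := piG [:: (x, false)].

End PresentedGroup.

(* A signed Gauss diagram.  Each crossing c is passed twice, by the strand
   through (c, true), which runs over, and by the strand through (c, false),
   which runs under.  [next] sends a passage to the following one along the
   orientation, and [positive c] says that c is a positive crossing, i.e. that
   the under-strand crosses the over-strand from right to left.
   The edge of the diagram that leaves a passage p, and so ends at [next p], is
   identified with p; in particular, the edge that enters p is next^-1 p. *)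
Record gauss_diagram := GaussDiagram {
  crossing : finType;
  next : {perm (crossing * bool)};
  positive : crossing -> bool
}.

Notation passage D := (crossing D * bool)%type.
Notation edge D := (crossing D * bool)%type.

(* A half-edge (p, true) is the start of the edge leaving the passage p, and
   (p, false) is the end of the edge entering p. *)
Notation half_edge D := (crossing D * bool * bool)%type.

Definition half_edge_flip (D : gauss_diagram) (h : half_edge D) : half_edge D :=
  let: (p, out) := h in
  if out then (next D p, false) else ((next D)^-1 p, true).

(* The counterclockwise successor of a half-edge around its crossing.  The four
   half-edges come in the cyclic order
     over-out, under-out, over-in, under-in   at a positive crossing,
     over-out, under-in, over-in, under-out   at a negative crossing. *)
Definition half_edge_rot (D : gauss_diagram) (h : half_edge D) : half_edge D :=
  let: (c, over, out) := h in
  (c, ~~ over, if over == positive c then out else ~~ out).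

(* The orbits of [face_next] are the boundaries of the regions of the closed
   surface carried by the Gauss diagram. *)
Definition face_next (D : gauss_diagram) (h : half_edge D) : half_edge D :=
  half_edge_rot (half_edge_flip h).

(* The carrier surface is the sphere iff its Euler characteristic is 2; the
   underlying 4-valent graph is connected as soon as [next D] is a single
   cycle. *)
Definition planar (D : gauss_diagram) : Prop :=
  (#|{: crossing D}| + fcard (@face_next D) predT = #|{: edge D}| + 2)%N.

(* A diagram on the sphere, with at least one crossing, of an oriented knot
   (one component). *)
Definition knot_diagram (D : gauss_diagram) : Prop :=
  [/\ (0 < #|{: crossing D}|)%N,
      forall p q : passage D, fconnect (next D) p q
    & planar D].

(* Arcs are the classes of edges for the equivalence relation generated by
   identifying the two edges at each over-passage. *)
Definition arc_adj (D : gauss_diagram) : rel (edge D) :=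
  fun e f => ((f == next D e) && f.2) || ((e == next D f) && e.2).

Definition same_arc (D : gauss_diagram) : rel (edge D) := connect (@arc_adj D).

Fact same_arc_refl (D : gauss_diagram) : reflexive (@same_arc D).
Proof. exact: connect0. Qed.

Fact same_arc_sym (D : gauss_diagram) : symmetric (@same_arc D).
Proof. by apply: sym_connect_sym => e f; rewrite /arc_adj orbC. Qed.

Fact same_arc_trans (D : gauss_diagram) : transitive (@same_arc D).
Proof. exact: connect_trans. Qed.

Canonical same_arc_equiv (D : gauss_diagram) :=
  EquivRel (@same_arc D) (@same_arc_refl D) (@same_arc_sym D)
    (@same_arc_trans D).

Definition arc (D : gauss_diagram) := {eq_quot @same_arc D}.

HB.instance Definition _ (D : gauss_diagram) := Choice.on (arc D).
HB.instance Definition _ (D : gauss_diagram) := EqQuotient.on (arc D).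

Definition arc_of (D : gauss_diagram) (e : edge D) : arc D := \pi_(arc D) e.

Definition over_arc (D : gauss_diagram) (c : crossing D) : arc D :=
  arc_of (c, true).

(* The under-arcs on the right and on the left of the oriented over-arc. *)
Definition right_arc (D : gauss_diagram) (c : crossing D) : arc D :=
  arc_of (if positive c then (next D)^-1 (c, false) else (c, false)).

Definition left_arc (D : gauss_diagram) (c : crossing D) : arc D :=
  arc_of (if positive c then (c, false) else (next D)^-1 (c, false)).

(* left = over * right * over^-1 at each crossing *)
Definition wirtinger (D : gauss_diagram) (u v : word (arc D)) : Prop :=
  exists c : crossing D,
    u = [:: (left_arc c, false)] /\
    v = [:: (over_arc c, false); (right_arc c, false); (over_arc c, true)].

Definition knot_group (D : gauss_diagram) := presented_group (@wirtinger D).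

HB.instance Definition _ (D : gauss_diagram) := Group.on (knot_group D).

Definition meridian (D : gauss_diagram) (a : arc D) : knot_group D :=
  pres_gen (@wirtinger D) a.

Notation representation D F := {multiplicative (knot_group D) -> (PSL2 F)}.

(* It is enough to consider the Wirtinger generators: every meridian is
   conjugate to one of them. *)
Definition boundary_parabolic (D : gauss_diagram) (F : fieldType)
    (rho : representation D F) : Prop :=
  forall a : arc D, parabolic (rho (meridian a)).

Definition conj_rep (D : gauss_diagram) (F : fieldType)
    (rho rho' : representation D F) : Prop :=
  exists g : PSL2 F, forall x : knot_group D, rho' x = g * rho x * g^-1.

Section ConnectedSum.
Variables D1 D2 : gauss_diagram.

Definition csum_crossing := (crossing D1 + crossing D2)%type.

Definition csum_inl (p : passage D1) : csum_crossing * bool := (inl p.1, p.2).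
Definition csum_inr (p : passage D2) : csum_crossing * bool := (inr p.1, p.2).

Variables (e1 : edge D1) (e2 : edge D2).

Definition csum_next_fun (p : csum_crossing * bool) : csum_crossing * bool :=
  match p with
  | (inl c, b) => if (c, b) == e1 then csum_inr (next D2 e2)
                  else csum_inl (next D1 (c, b))
  | (inr c, b) => if (c, b) == e2 then csum_inl (next D1 e1)
                  else csum_inr (next D2 (c, b))
  end.

Fact csum_next_inj : injective csum_next_fun.
Proof.
have inlI p q : csum_inl p = csum_inl q -> p = q.
  by case: p q => [c b] [c' b'] [-> ->].
have inrI p q : csum_inr p = csum_inr q -> p = q.
  by case: p q => [c b] [c' b'] [-> ->].
move=> [[c|c] b] [[c'|c'] b'] /=;
  do 2![case: eqP => [?|?]] => //;
  (try by move=> _; congruence);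
  try by [move=> /inlI/perm_inj; congruence | move=> /inrI/perm_inj; congruence].
Qed.

Definition csum_next : {perm csum_crossing * bool} := perm csum_next_inj.

Definition csum_positive (c : csum_crossing) : bool :=
  match c with inl c1 => positive c1 | inr c2 => positive c2 end.

(* D1 # D2, formed by cutting the edges e1 and e2 and joining the ends
   compatibly with the orientations: the two connecting edges are
   [csum_inl e1], from the start of e1 to the end of e2, and [csum_inr e2], from
   the start of e2 to the end of e1.  On the sphere this surgery has a unique
   planar realization. *)
Definition connected_sum : gauss_diagram :=
  GaussDiagram csum_next csum_positive.

(* rho is obtained from rho1 and rho2 by the connected sum construction: after
   conjugating rho1 and rho2 so that they agree on the cut arcs, every arc of
   D1 # D2 has the color given by D1 or by D2; the connecting arcs, i.e. those
   of [csum_inl e1] and [csum_inr e2], then have the common color of the two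
   cut arcs. *)
Definition is_connected_sum_rep (F : fieldType)
    (rho1 : representation D1 F) (rho2 : representation D2 F)
    (rho : representation connected_sum F) : Prop :=
  exists (rho1' : representation D1 F) (rho2' : representation D2 F),
    [/\ conj_rep rho1 rho1', conj_rep rho2 rho2',
        rho1' (meridian (arc_of e1)) = rho2' (meridian (arc_of e2)),
        forall e : edge D1,
          rho (meridian (@arc_of connected_sum (csum_inl e)))
            = rho1' (meridian (arc_of e))
      & forall e : edge D2,
          rho (meridian (@arc_of connected_sum (csum_inr e)))
            = rho2' (meridian (arc_of e))].

Definition decomposes (F : fieldType) (rho : representation connected_sum F)
    (rho1 : representation D1 F) (rho2 : representation D2 F) : Prop :=
  exists2 rho' : representation connected_sum F,
    conj_rep rho rho' & is_connected_sum_rep rho1 rho2 rho'.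

End ConnectedSum.

(* Main.v *)
Require Import Defs.
From HB Require Import structures.
From mathcomp Require Import all_boot all_order all_algebra perm zify.
From mathcomp Require Import boolp reals complex.

(* The two connecting arcs of D1 # D2 carry the same meridian, because D1 is
   planar; hence every arc of D1 and of D2 has a colour in the group of
   K1 # K2, these colours satisfy the Wirtinger relations, and pulling rho back
   along the resulting maps pi_1(K_j) -> pi_1(K1 # K2) gives rho_j.  Uniqueness
   holds because the colouring of D1 # D2 determines those of D1 and D2.

   For the equality of the connecting meridians, cut D1 along e1 and colour the
   half-edges by the knot group of D1 # D2.  The product of the colours around
   each crossing is trivial.  Start from one disc for each crossing and glue
   bands along the edges one by one: this multiplies the permutation of the
   half-edges, whose cycles are the boundary curves, by a transposition, which
   joins two curves or splits one.  By the Euler formula no step joins two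
   curves of the same component.  Then the property "on each component, the
   holonomies of the boundary curves are all trivial as soon as all but one
   are" is preserved.  In the end the curves are the faces of D1, and their
   holonomies are trivial except perhaps for one face adjacent to e1, around
   which the holonomy compares the colours of the two ends of e1. *)

Set Implicit Arguments.
Unset Strict Implicit.
Unset Printing Implicit Defensive.

(** * Holonomy along the cycles of a permutation, and its change under a transposition *)

Section Holonomy.
Local Open Scope group_scope.
Variables (T : finType) (G : groupType).
Implicit Types (phi : {perm T}) (g f : T -> G) (x y z u : T) (r : G).

(* The holonomy of [g] around the cycle of [z] is trivial: under the lift
   [(u, a) |-> (phi u, g u * a)] of [phi] to [T * G], that cycle lifts to closed
   cycles. *)
Definition flat phi g z :=
  exists f, forall u, u \in porbit phi z -> f (phi u) = g u * f u.

Lemma porbit_next phi z u : (phi u \in porbit phi z) = (u \in porbit phi z).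
Proof.
by rewrite -!eq_porbit_mem; have /= := porbit_perm phi 1 u; rewrite expg1 => ->.
Qed.

Lemma porbit_ind phi z (P : T -> Prop) :
  P z -> (forall u, P u -> P (phi u)) -> forall u, u \in porbit phi z -> P u.
Proof.
move=> Pz Pn u /porbitP[i ->]; elim: i => [|i IH]; first by rewrite expg0 perm1.
by rewrite expgSr permM; apply: Pn.
Qed.

(** The walk from [phi y] back to [y] takes every step of the cycle except the one leaving [y], so
    invariance along those steps forces it along the missing one. *)
Lemma porbit_const (S : Type) phi y (k : T -> S) :
  (forall u, u \in porbit phi y -> u != y -> k (phi u) = k u) ->
  k (phi y) = k y.
Proof.
move=> kE.
have exn : exists n, iter n.+1 phi y == y.
  have := iter_porbit phi y; have := card_porbit_neq0 phi y.
  by case: #|_| => // n _ /eqP; exists n.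
case: (ex_minnP exn) => n /eqP nE minn.
suff H i : (i <= n)%N -> k (iter i.+1 phi y) = k (phi y) by rewrite -(H n) ?nE.
elim: i => // i IHi lt_in; rewrite iterS kE ?IHi //; first exact: ltnW.
  by rewrite -permX mem_porbit.
by apply: contraTN lt_in => /minn; rewrite -leqNgt.
Qed.

Lemma flat_orbit phi g z z' : z' \in porbit phi z -> flat phi g z -> flat phi g z'.
Proof.
by rewrite -eq_porbit_mem => /eqP zz' [f fE]; exists f => u; rewrite zz'; apply: fE.
Qed.

Lemma eq_flat phi g phi' g' z :
  (forall u, u \in porbit phi z -> phi' u = phi u /\ g' u = g u) ->
  porbit phi' z = porbit phi z /\ (flat phi g z <-> flat phi' g' z).
Proof.
move=> E.
have pE : porbit phi' z = porbit phi z.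
  have iE i : (phi' ^+ i) z = (phi ^+ i) z.
    elim: i => [|i IH]; first by rewrite !expg0 !perm1.
    by rewrite !expgSr !permM IH; case: (E ((phi ^+ i) z)) => //; apply: mem_porbit.
  by apply/porbit_setP => u; apply/porbitP/porbitP => -[i ->]; exists i.
split=> //; rewrite /flat pE; split=> -[f fE]; exists f => u zu;
  have [phiE gE] := E u zu; first by rewrite phiE gE fE.
by rewrite -phiE -gE fE.
Qed.

(* The lift of the transposition [tperm x y] that sends the sheet [a] over [x]
   to the sheet [r * a] over [y]; it is an involution. *)
Definition swap_step x y r z : G := if z == x then r else if z == y then r^-1 else 1.

(** The lift given by [(phi', g')] is the lifted transposition followed by the lift given by
    [(phi, g)]. *)
Definition swapped x y r phi g phi' g' :=
  (forall z, phi' z = phi (tperm x y z)) /\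
  (forall z, g' z = g (tperm x y z) * swap_step x y r z).

Lemma swapped_sym x y r phi g phi' g' : x != y ->
  swapped x y r phi g phi' g' -> swapped x y r phi' g' phi g.
Proof.
move=> xy [phiE gE]; split=> z; first by rewrite phiE tpermK.
rewrite gE tpermK -mulgA /swap_step.
case: tpermP => [->|->|/eqP zx /eqP zy]; rewrite ?eqxx 1?eq_sym ?(negPf xy).
- by rewrite mulVg mulg1.
- by rewrite mulgV mulg1.
by rewrite (negPf zy) [x == z]eq_sym (negPf zx) !mulg1.
Qed.

Lemma swappedC x y r phi g phi' g' : x != y ->
  swapped x y r phi g phi' g' -> swapped y x r^-1 phi g phi' g'.
Proof.
move=> xy [phiE gE]; split=> z; rewrite tpermC // gE; congr (_ * _).
rewrite /swap_step; case: eqP => [->|//]; case: eqP => //.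
  by move/eqP; rewrite (negPf xy).
by rewrite invgK.
Qed.

Section Swap.
Variables (x y : T) (r : G) (phi phi' : {perm T}) (g g' : T -> G).
Hypothesis (sw : swapped x y r phi g phi' g').

Lemma swapped_off u : u != x -> u != y -> phi' u = phi u /\ g' u = g u.
Proof.
case: sw => phiE gE ux uy; rewrite phiE gE tpermD 1?eq_sym //.
by rewrite /swap_step (negPf ux) (negPf uy) mulg1.
Qed.

Lemma swapped_subset z :
  z \in porbit phi x :|: porbit phi y ->
  porbit phi' z \subset porbit phi x :|: porbit phi y.
Proof.
move=> zA; apply/subsetP; apply: porbit_ind => // u.
rewrite sw.1 !inE !porbit_next.
by case: tpermP => [->|->|]; rewrite // !porbit_id ?orbT.
Qed.
End Swap.

Lemma swapped_union x y r phi g phi' g' : x != y ->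
  swapped x y r phi g phi' g' ->
  porbit phi' x :|: porbit phi' y = porbit phi x :|: porbit phi y.
Proof.
move=> xy sw; apply/eqP; rewrite eqEsubset !subUset.
have sw' := swapped_sym xy sw.
by rewrite !(swapped_subset sw) ?(swapped_subset sw') // !inE porbit_id ?orbT.
Qed.

Lemma swapped_out x y r phi g phi' g' z : x != y ->
  swapped x y r phi g phi' g' ->
  z \notin porbit phi x -> z \notin porbit phi y ->
  porbit phi' z = porbit phi z /\ (flat phi g z <-> flat phi' g' z).
Proof.
move=> xy sw zx zy; apply: eq_flat => u zu; apply: (swapped_off sw).
  by apply: contraNneq zx => <-; rewrite porbit_sym.
by apply: contraNneq zy => <-; rewrite porbit_sym.
Qed.

(** Right translation preserves the equation for [f]. The constant [c] adjusts the solution over the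
    cycle of [y] so that its value at [y] is [r] times that of the other solution at [x], as the
    lifted swap demands. *)
Lemma flat_join x y r phi g phi' g' : x != y ->
  swapped x y r phi g phi' g' -> y \notin porbit phi x ->
  flat phi g x -> flat phi g y -> flat phi' g' x.
Proof.
move=> xy sw yx [fx fxE] [fy fyE].
pose c := (fy y)^-1 * (r * fx x).
pose f u := if u \in porbit phi y then fy u * c else fx u.
have fyy : f y = r * fx x by rewrite /f porbit_id /c mulVKg.
have fxx : f x = fx x by rewrite /f porbit_sym (negPf yx).
have fE u : u \in porbit phi x :|: porbit phi y -> f (phi u) = g u * f u.
  rewrite !inE /f porbit_next; case: ifP => [uy _|_].
    by rewrite fyE // -mulgA.
  by rewrite orbF; apply: fxE.
exists f => u ux.
have {ux} uA : u \in porbit phi x :|: porbit phi y.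
  by apply: (subsetP (swapped_subset sw _)) ux; rewrite !inE porbit_id.
rewrite sw.1 sw.2 /swap_step.
case: tpermP => [->|->|/eqP ux /eqP uy].
- by rewrite eqxx fE ?fyy ?fxx ?mulgA // !inE porbit_id orbT.
- by rewrite eq_sym (negPf xy) eqxx fE ?fyy ?fxx ?inE ?porbit_id // -mulgA mulKg.
by rewrite (negPf ux) (negPf uy) mulg1 fE.
Qed.

Lemma flat_unjoin x y r phi g phi' g' : x != y ->
  swapped x y r phi g phi' g' -> y \notin porbit phi x ->
  y \in porbit phi' x -> flat phi' g' x -> flat phi g y -> flat phi g x.
Proof.
move=> xy sw yx yx' [f fE] [fy fyE].
have joined u : u \in porbit phi x :|: porbit phi y -> u \in porbit phi' x.
  rewrite -(swapped_union xy sw) inE.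
  by move: yx'; rewrite -eq_porbit_mem => /eqP ->; rewrite orbb.
have fE' u : u \in porbit phi x :|: porbit phi y -> u != x -> u != y ->
    f (phi u) = g u * f u.
  move=> uA ux uy; have [<- <-] := swapped_off sw ux uy.
  exact/fE/joined.
(* The ratio of [f] to [fy] is unchanged by every step of the cycle of [y] except perhaps the one
   leaving [y], hence by that one too. *)
have fyy : f (phi y) = g y * f y.
  pose k u := (fy u)^-1 * f u.
  have : k (phi y) = k y.
    apply: porbit_const => u uy nuy; rewrite /k fyE // fE' ?inE ?uy ?orbT //.
      by rewrite invgM -mulgA mulKg.
    by apply: contraNneq yx => <-; rewrite porbit_sym.
  by rewrite /k fyE ?porbit_id // invgM -mulgA => /mulgI <-; rewrite mulVKg.
have fxy : f y = r * f x.
  apply: (@mulgI _ (g y)); rewrite -fyy mulgA.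
  have := fE x (porbit_id _ _); rewrite sw.1 sw.2 tpermL => ->.
  by rewrite /swap_step eqxx.
exists f => u ux; have uA : u \in porbit phi x :|: porbit phi y by rewrite inE ux.
have nuy : u != y by apply: contraNneq yx => <-.
have [->|nux] := eqVneq u x; last exact: fE'.
have := fE y yx'; rewrite sw.1 sw.2 tpermR => ->.
by rewrite /swap_step eq_sym (negPf xy) eqxx fxy -mulgA mulKg.
Qed.

(* [l] labels the components of a surface whose boundary curves are the cycles
   of [phi]: on each component, the boundary curves are all flat as soon as
   all but one are, as happens on a sphere with holes. *)
Definition spherical (L : Type) (l : T -> L) phi g :=
  forall z, (forall u, l u = l z -> u \notin porbit phi z -> flat phi g u) ->
  flat phi g z.

Definition merge (L : eqType) (l : T -> L) x y z := if l z == l x then l y else l z.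

Lemma label_porbit (L : eqType) (l : T -> L) phi z u :
  (forall v, l (phi v) = l v) -> u \in porbit phi z -> l u = l z.
Proof. by move=> lphi; apply: (porbit_ind (P := fun u => l u = l z)) => // v lv; rewrite lphi. Qed.

(** On the joined curve: all other curves of both old components are flat, so the two old curves are
    flat, and so is their join. Elsewhere on the merged component: the joined curve is flat, and the
    old component not containing [z] makes its own half flat; removing that half leaves the other
    one flat. *)
Lemma spherical_merge (L : eqType) (l : T -> L) x y r phi g phi' g' :
  x != y -> swapped x y r phi g phi' g' ->
  (forall v, l (phi v) = l v) -> l x != l y ->
  spherical l phi g -> spherical (merge l x y) phi' g'.
Proof.
move=> xy sw lphi lxy sph.
have off u a : l u != l a -> u \notin porbit phi a.
  by apply: contraNN => /(label_porbit lphi) ->.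
have mx : merge l x y x = l y by rewrite /merge eqxx.
have my : merge l x y y = l y by rewrite /merge eq_sym (negPf lxy).
have mE u : (merge l x y u == l y) = (l u == l x) || (l u == l y).
  by rewrite /merge; case: (eqVneq (l u) (l x)); rewrite ?eqxx.
have yx : y \notin porbit phi x by rewrite off // eq_sym.
have xy' : x \notin porbit phi y by rewrite off.
have joined : porbit phi' x = porbit phi' y.
  (* Together the two cycle counts say that [x] and [y] share a cycle of exactly one of [phi] and
     [phi']. *)
  have /= := porbits_mul_tperm phi x y; have /= := porbits_mul_tperm phi' x y.
  have -> : tperm x y * phi' = phi.
    by apply/permP => u; rewrite permM sw.1 tpermK.
  have -> : tperm x y * phi = phi' by apply/permP => u; rewrite permM sw.1.
  rewrite xy' xy /= => h1 h2; apply/eqP; rewrite eq_porbit_mem.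
  by case: (x \in _) h1 => //=; lia.
have joinedE u : (u \in porbit phi' x) = (u \in porbit phi x) || (u \in porbit phi y).
  by move/setP/(_ u): (swapped_union xy sw); rewrite !inE -joined orbb.
have sw' := swapped_sym xy sw.
move=> z flat_z.
have out u : u \notin porbit phi x -> u \notin porbit phi y ->
    porbit phi' u = porbit phi u /\ (flat phi g u <-> flat phi' g' u).
  exact: (swapped_out xy sw).
case: (boolP (z \in porbit phi' x)) => zx.
  have pz : porbit phi' z = porbit phi' x by apply/eqP; rewrite eq_porbit_mem.
  have lz : merge l x y z = l y.
    by apply/eqP; rewrite mE; move: zx; rewrite joinedE => /orP[] /(label_porbit lphi) ->;
      rewrite eqxx ?orbT.
  have flat_off u : merge l x y u == l y -> u \notin porbit phi x ->
      u \notin porbit phi y -> flat phi g u.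
    move=> /eqP mu ux uy; apply/(out u ux uy).2/flat_z; first by rewrite mu lz.
    by rewrite pz joinedE (negPf ux) (negPf uy).
  have fx : flat phi g x.
    apply: sph => u lu ux; apply: flat_off => //; first by rewrite mE lu eqxx.
    by apply: off; rewrite lu.
  have fy : flat phi g y.
    apply: sph => u lu uy; apply: flat_off => //; first by rewrite mE lu eqxx orbT.
    by apply: off; rewrite lu eq_sym.
  by apply: (flat_orbit zx); apply: (flat_join xy sw).
have [nzx nzy] : z \notin porbit phi x /\ z \notin porbit phi y.
  by apply/andP; rewrite -negb_or -joinedE.
have [pz flatE] := out z nzx nzy; apply/flatE.
case: (boolP ((l z == l x) || (l z == l y))) => lz; last first.
  apply: sph => u lu uz; move: lz; rewrite -lu negb_or => /andP[lux luy].
  apply/(out u (off _ _ lux) (off _ _ luy)).2/flat_z; last by rewrite pz.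
  by rewrite /merge lu.
have mz : merge l x y z = l y by apply/eqP; rewrite mE.
have fxy' : flat phi' g' x.
  by apply: flat_z; rewrite ?mx ?mz // porbit_sym.
have one_side a b s : a != b -> swapped a b s phi g phi' g' ->
    b \notin porbit phi a -> l a != l b -> b \in porbit phi' a ->
    (forall u, (u \in porbit phi' a) = (u \in porbit phi a) || (u \in porbit phi b)) ->
    (forall u, u \notin porbit phi a -> u \notin porbit phi b ->
       merge l x y u = l y -> u \notin porbit phi z -> flat phi g u) ->
    (merge l x y a = l y) -> (forall u, l u = l b -> merge l x y u = l y) ->
    flat phi' g' a -> l z = l a -> flat phi g z.
  move=> ab swab ba lab ba' jE fo ma mb fa lza.
  have fb : flat phi g b.
    apply: sph => u lu ub; apply: fo => //; last 2 [exact: mb].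
      by apply: off; rewrite lu eq_sym.
    by apply: off; rewrite lu lza eq_sym.
  have fa' : flat phi g a by apply: (flat_unjoin ab swab).
  apply: sph => u lu uz.
  case: (boolP (u \in porbit phi a)) => ua; first exact: (flat_orbit ua).
  apply: fo => //; first by apply: off; rewrite lu lza.
  by move: mz; rewrite /merge lu.
have fo u : u \notin porbit phi x -> u \notin porbit phi y ->
    merge l x y u = l y -> u \notin porbit phi z -> flat phi g u.
  by move=> ux uy mu uz; apply/(out u ux uy).2/flat_z; rewrite ?mu ?mz ?pz.
case/orP: lz => /eqP lz.
  apply: (one_side x y r) => //; first by rewrite joined porbit_id.
  by move=> u lu; apply/eqP; rewrite mE lu eqxx orbT.
apply: (one_side y x r^-1) => //.
- by rewrite eq_sym.
- exact: swappedC.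
- by rewrite eq_sym.
- by rewrite -joined porbit_id.
- by move=> u; rewrite -joined joinedE orbC.
- by move=> u uy ux; apply: fo.
- by move=> u lu; apply/eqP; rewrite mE lu eqxx.
by apply: flat_orbit fxy'; rewrite joined porbit_id.
Qed.

(** On one half of the split curve: the other curves of the component are flat, hence so is the
    unsplit curve, and removing the other, flat half leaves this one flat. Elsewhere on the
    component: both halves are flat, so their join is. *)
Lemma spherical_split (L : eqType) (l : T -> L) x y r phi g phi' g' :
  x != y -> swapped x y r phi g phi' g' ->
  (forall v, l (phi v) = l v) -> l x = l y -> y \notin porbit phi' x ->
  spherical l phi g -> spherical l phi' g'.
Proof.
move=> xy sw lphi lxy yx' sph z flat_z.
have sw' := swapped_sym xy sw.
have yx : porbit phi x = porbit phi y.
  have /= := porbits_mul_tperm phi x y; have /= := porbits_mul_tperm phi' x y.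
  have -> : tperm x y * phi' = phi.
    by apply/permP => u; rewrite permM sw.1 tpermK.
  have -> : tperm x y * phi = phi' by apply/permP => u; rewrite permM sw.1.
  rewrite porbit_sym yx' xy /= => h1 h2; apply/eqP; rewrite eq_porbit_mem.
  by case: (x \in _) h2 => //=; lia.
have splitE u : (u \in porbit phi x) = (u \in porbit phi' x) || (u \in porbit phi' y).
  by move/setP/(_ u): (swapped_union xy sw); rewrite !inE -yx orbb.
have out u : u \notin porbit phi x ->
    porbit phi' u = porbit phi u /\ (flat phi g u <-> flat phi' g' u).
  by move=> ux; apply: (swapped_out xy sw); rewrite -?yx.
have in_one a b s : a != b -> swapped a b s phi' g' phi g ->
    b \notin porbit phi' a -> b \in porbit phi a -> porbit phi a = porbit phi x ->
    {subset porbit phi' a <= porbit phi x} ->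
    z \in porbit phi' a -> l a = l x -> l b = l x -> flat phi' g' z.
  move=> ab swab ba ba' pa sub za la lb.
  have za' : porbit phi' z = porbit phi' a by apply/eqP; rewrite eq_porbit_mem.
  have zx := sub z za.
  have lz : l z = l x by apply: label_porbit zx.
  have fb : flat phi' g' b by apply: flat_z; rewrite ?lb ?lz // za'.
  apply: (flat_orbit za); apply: (flat_unjoin ab swab) => //.
  apply: sph => u lu; rewrite pa => ux; apply/(out u ux).2/flat_z.
    by rewrite lu la lz.
  by apply: contraNN ux; rewrite za'; apply: sub.
case: (boolP (z \in porbit phi x)) => zx.
  move: (zx); rewrite splitE => /orP[] za.
    apply: (in_one x y r) => //; first by rewrite yx porbit_id.
    by move=> u ux; rewrite splitE ux.
  apply: (in_one y x r^-1) => //; first by rewrite eq_sym.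
  - exact: swappedC.
  - by rewrite porbit_sym.
  - by rewrite -yx porbit_id.
  by move=> u uy; rewrite splitE uy orbT.
have [pz flatE] := out z zx; apply/flatE; apply: sph => u lu uz.
case: (boolP (u \in porbit phi x)) => ux; last first.
  by apply/(out u ux).2/flat_z => //; rewrite pz.
have lzx : l x = l z by rewrite -lu; apply/esym; apply: label_porbit ux.
have notin a : a \in porbit phi x -> a \notin porbit phi' z.
  move=> ax; rewrite pz; apply: contraNN zx.
  by rewrite -!eq_porbit_mem => /eqP <-; rewrite eq_porbit_mem.
apply: (flat_orbit ux); apply: (flat_join xy sw' yx').
  by apply: flat_z => //; apply: notin; rewrite porbit_id.
by apply: flat_z; rewrite -?lxy //; apply: notin; rewrite yx porbit_id.
Qed.
End Holonomy.

Lemma fcard_porbits (T : finType) (f : T -> T) (phi : {perm T}) :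
  phi =1 f -> (fcard f predT <= #|porbits phi|)%N.
Proof.
move=> phiE.
have sub x y : y \in porbit phi x -> fconnect f x y.
  move=> yx; apply: (porbit_ind (P := fun y => fconnect f x y)) yx; first exact: connect0.
  move=> u xu; rewrite phiE; apply: connect_trans xu _; exact: fconnect1.
have fsym : connect_sym (frel f).
  by apply: fconnect_sym; move=> u v; rewrite -!phiE; apply: perm_inj.
rewrite /n_comp_mem.
rewrite -(@card_in_imset _ _ (porbit phi)); last first.
  move=> x y; rewrite !inE !andbT => /eqP rx /eqP ry /eqP; rewrite eq_porbit_mem => xy.
  rewrite -rx -ry; apply/esym/eqP; rewrite root_connect //; exact: sub.
apply: subset_leq_card; apply/subsetP => _ /imsetP[x _ ->].
exact: imset_f.
Qed.

(** * The ribbon surface of a Gauss diagram, glued band by band *)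

Section Diagram.
Local Notation next := Defs.next.
Local Open Scope group_scope.
Variables (D : gauss_diagram) (G : groupType).
Implicit Types (h : half_edge D) (e p : passage D) (s : seq (edge D)).

Definition half_edge_edge h : edge D := if h.2 then h.1 else (next D)^-1 h.1.

Lemma half_edge_flipK : involutive (@half_edge_flip D).
Proof. by case=> p [] /=; rewrite ?permK ?permKV. Qed.

Lemma half_edge_edge_flip h : half_edge_edge (half_edge_flip h) = half_edge_edge h.
Proof. by case: h => p [] /=; rewrite /half_edge_edge /= ?permK. Qed.

Lemma half_edge_rot2 p b : half_edge_rot (half_edge_rot (p, b)) = (p, ~~ b).
Proof. by case: p b => [c []] [] /=; case: (positive c). Qed.

Lemma half_edge_rot_inj : injective (@half_edge_rot D).
Proof.
move=> [p b] [p' b'] /(congr1 (fun h => half_edge_rot (half_edge_rot (half_edge_rot h)))).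
by rewrite !half_edge_rot2 !negbK.
Qed.

Definition glue_flip s h := if half_edge_edge h \in s then half_edge_flip h else h.

Lemma glue_flipK s : involutive (glue_flip s).
Proof.
move=> h; rewrite /glue_flip; case hs: (half_edge_edge h \in s); last by rewrite hs.
by rewrite half_edge_edge_flip hs half_edge_flipK.
Qed.

(* The boundary curves of the surface obtained from the crossing discs by
   gluing the bands of the edges in [s]. *)
Definition boundary_perm s : {perm half_edge D} :=
  perm (inv_inj (glue_flipK s)) * perm half_edge_rot_inj.

Lemma boundary_permE s h : boundary_perm s h = half_edge_rot (glue_flip s h).
Proof. by rewrite permM !permE. Qed.

Variables (kin kout : passage D -> G).

(** A free end contributes its colour, inverted if incoming. A glued edge contributes the
    discrepancy between the colours of its two ends, all of it on one side. *)
Definition boundary_weight s h : G :=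
  if half_edge_edge h \in s then
    if h.2 then (kin (next D h.1))^-1 * kout h.1 else 1
  else if h.2 then kout h.1 else (kin h.1)^-1.

Lemma boundary_swapped e s : e \notin s ->
  swapped (e, true) (next D e, false) (kout e)
    (boundary_perm s) (boundary_weight s)
    (boundary_perm (e :: s)) (boundary_weight (e :: s)).
Proof.
move=> es; have eE h : (half_edge_edge h == e) = (h == (e, true)) || (h == (next D e, false)).
  case: h => p []; rewrite /half_edge_edge /= !xpair_eqE ?andbT ?andbF ?orbF //=.
  by rewrite -(inj_eq (@perm_inj _ (next D))) permKV.
have [ex ey] : half_edge_edge (e, true) = e /\ half_edge_edge (next D e, false) = e.
  by rewrite /half_edge_edge /= permK.
have neq : (next D e, false) == (e, true) = false by rewrite xpair_eqE andbF.
split=> h; rewrite ?boundary_permE /glue_flip /boundary_weight /swap_step inE eE.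
  by case: tpermP => [->|->|/eqP/negPf -> /eqP/negPf ->];
    rewrite ?eqxx ?orbT ?ex ?ey ?(negPf es) //= permK.
case: tpermP => [->|->|/eqP/negPf -> /eqP/negPf ->] //=; last by rewrite mulg1.
  by rewrite eqxx ey (negPf es).
by rewrite eqxx orbT ex (negPf es) neq mulgV.
Qed.

(* [kin p] and [kout p] are the colours of the edges that enter and leave [p]:
   they are not required to agree along an edge, so that an edge can be cut. *)
Definition wirtinger_colouring : Prop :=
  (forall c, kin (c, true) = kout (c, true)) /\
  forall c, if positive c
    then kout (c, false) = kout (c, true) * kin (c, false) * (kout (c, true))^-1
    else kin (c, false) = kout (c, true) * kout (c, false) * (kout (c, true))^-1.

Hypothesis colouring : wirtinger_colouring.

Lemma crossing_flat h : flat (boundary_perm [::]) (boundary_weight [::]) h.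
Proof.
(* Starting from 1 at the outgoing over-strand, [f] accumulates the colours met counterclockwise; it
   closes up by the Wirtinger relation. *)
pose f (h : half_edge D) : G := let: (c, o, b) := h in
  match o, b with
  | true, true => 1
  | true, false => if positive c then kout (c, false) * kout (c, true)
                   else (kin (c, false))^-1 * kout (c, true)
  | false, b => if positive c == b then kout (c, true)
      else (kout (c, true))^-1 *
        (if positive c then kout (c, false) else (kin (c, false))^-1) * kout (c, true)
  end.
exists f => -[[c o] b] _; rewrite boundary_permE /glue_flip /boundary_weight /=.
move: (colouring.2 c) (colouring.1 c).
case: (positive c) => uE oE; case: o b => [] [] /=; rewrite ?oE ?mulg1 ?uE;
  rewrite ?mulgA ?mulVg ?mul1g ?mulgVK ?mulgK //.
  by rewrite mulVg.
by rewrite !invgM invgK !mulgA !mulgVK mulgV.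
Qed.

Lemma card_crossing_discs : (#|porbits (boundary_perm [::])| <= #|{: crossing D}|)%N.
Proof.
rewrite -cardsT.
suff /subset_leq_card : porbits (boundary_perm [::]) \subset
    (fun c => porbit (boundary_perm [::]) (c, true, true)) @: setT.
  by move=> H; apply: leq_trans H (leq_imset_card _ _).
apply/subsetP => _ /imsetP[[[c o] b] _ ->]; apply/imsetP; exists c => //.
apply/eqP; rewrite eq_porbit_mem.
have step h : boundary_perm [::] h = half_edge_rot h by rewrite boundary_permE.
have orb n : iter n (@half_edge_rot D) (c, true, true) \in
    porbit (boundary_perm [::]) (c, true, true).
  by elim: n => [|n IH]; rewrite ?porbit_id // iterS -step porbit_next.
move: (orb 0%N) (orb 1%N) (orb 2%N) (orb 3%N); rewrite /=.
by case: (positive c) o b => [] [] [].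
Qed.

(** Capping the n boundary curves gives a closed surface of Euler characteristic V - |s| + n, at
    most 2 per component, with equality when all components are spheres. Equality after gluing a
    band implies equality before, so sphericity passes through the induction. *)
Lemma gluing_spherical s : uniq s ->
  exists l : half_edge D -> crossing D,
  [/\ forall h, l (half_edge_rot h) = l h,
      forall h, half_edge_edge h \in s -> l (half_edge_flip h) = l h,
      (#|porbits (boundary_perm s)| + #|{: crossing D}|
        <= 2 * #|l @: setT| + size s)%N
    & (#|porbits (boundary_perm s)| + #|{: crossing D}|
        = 2 * #|l @: setT| + size s)%N ->
      spherical l (boundary_perm s) (boundary_weight s)].
Proof.
elim: s => [_|e s IH]; last rewrite cons_uniq => /andP[es us].
  exists (fun h => h.1.1); split => //.
  - by case=> [[c o] b].
  - have -> : [set h.1.1 | h in [set: half_edge D]] = setT.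
      by apply/setP => c; rewrite inE; apply/imsetP; exists (c, true, true).
    by have := card_crossing_discs; rewrite cardsT; lia.
  by move=> _ z _; apply: crossing_flat.
have [l [lrot lflip le_card sph]] := IH us.
pose x : half_edge D := (e, true); pose y : half_edge D := (next D e, false).
have xy : x != y by rewrite xpair_eqE andbF.
have sw := boundary_swapped es; rewrite -/x -/y in sw.
have lphi h : l (boundary_perm s h) = l h.
  by rewrite boundary_permE lrot /glue_flip; case: ifP => // /lflip.
have flipE h : half_edge_edge h = e -> half_edge_flip h = tperm x y h.
  by rewrite /x /y; case: h => p [] <-; rewrite /half_edge_edge /= ?permKV ?tpermL ?tpermR.
have cardE := porbits_mul_tperm (boundary_perm s) x y; rewrite /= xy in cardE.
have card'E := porbits_mul_tperm (boundary_perm (e :: s)) x y; rewrite /= xy in card'E.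
have pE : tperm x y * boundary_perm s = boundary_perm (e :: s).
  by apply/permP => h; rewrite permM sw.1.
have p'E : tperm x y * boundary_perm (e :: s) = boundary_perm s.
  by rewrite -pE mulgA tperm2 mul1g.
rewrite pE in cardE; rewrite p'E in card'E.
set n := #|porbits (boundary_perm s)| in le_card sph cardE card'E.
set n' := #|porbits (boundary_perm (e :: s))| in cardE card'E *.
set V := #|{: crossing D}| in le_card sph *.
set m := #|l @: setT| in le_card sph.
have [lxy|lxy] := eqVneq (l x) (l y).
  exists l; split=> //.
  - move=> h; rewrite inE => /orP[/eqP/flipE ->|/lflip //].
    by case: tpermP => // ->.
  - by move: cardE le_card; rewrite -/m /=; case: (_ \notin _); lia.
  (* Joining two curves of one component would fall short of the bound by 2, so the band splits a
     curve. *)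
  move=> eq_card; have yx : y \notin porbit (boundary_perm (e :: s)) x.
    rewrite porbit_sym.
    by move: cardE card'E eq_card le_card; rewrite -/m /=; do 2!case: (_ \notin _) => //; lia.
  apply: (spherical_split xy sw) => //; apply: sph.
  by move: card'E eq_card; rewrite porbit_sym yx -/m /=; lia.
have xy' : x \notin porbit (boundary_perm s) y.
  by apply: contraNN lxy => /(label_porbit lphi) ->.
have le_m : (m <= #|merge l x y @: setT|.+1)%N.
  have : l @: setT \subset l x |: (merge l x y @: setT).
    apply/subsetP => _ /imsetP[h _ ->]; rewrite !inE.
    case: (eqVneq (l h) (l x)) => //= lh; apply/imsetP; exists h => //.
    by rewrite /merge (negPf lh).
  move/subset_leq_card/leq_trans; apply.
  by rewrite cardsU1; case: (_ \notin _); lia.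
rewrite xy' /= in cardE.
set m' := #|merge l x y @: setT| in le_m.
exists (merge l x y); split=> [h|h||eq_card].
- by rewrite /merge lrot.
- rewrite inE => /orP[/eqP/flipE ->|/lflip]; last by rewrite /merge => ->.
  by rewrite /merge; case: tpermP => [->|->|//]; rewrite eqxx; case: eqP.
- by move: le_card; rewrite -/m' /=; lia.
by apply: (spherical_merge xy sw) => //; apply: sph;
  move: le_card eq_card; rewrite -/m -/m' /=; lia.
Qed.

Lemma long_knot_colour e : knot_diagram D ->
  (forall p, p != e -> kin (next D p) = kout p) -> kin (next D e) = kout e.
Proof.
case=> _ conn euler glued.
pose s := enum {: edge D}; have us : uniq s by apply: enum_uniq.
have [l [lrot lflip le_card]] := gluing_spherical us.
have in_s h : half_edge_edge h \in s by rewrite mem_enum.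
have permE' : boundary_perm s =1 @face_next D.
  by move=> h; rewrite boundary_permE /glue_flip in_s.
(* Labels are constant: two rotations pass straight through a crossing, a flip leads to the next
   passage, and [next D] is a single cycle. *)
have card1 : (#|l @: setT| <= 1)%N.
  have lout p b : l (p, b) = l (p, true).
    by case: b => //; rewrite -(lrot (p, false)) -lrot half_edge_rot2.
  have lnext p : l (next D p, true) = l (p, true).
    by have := lflip (p, true) (in_s _); rewrite /= lout.
  have lconst p q : l (q, true) = l (p, true).
    have /iter_findex <- := conn p q.
    by elim: findex => //= n <-; rewrite lnext.
  have [c0 _|no] := pickP (crossing D); last first.
    rewrite (leq_trans (leq_imset_card _ _)) // leqNgt.
    by apply/negP => /ltnW/card_gt0P[[[c o] b]]; have := no c.
  rewrite -(cards1 (l (c0, true, true))); apply/subset_leq_card/subsetP.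
  by move=> _ /imsetP[[p b] _ ->]; rewrite inE lout (lconst (c0, true)).
have size_s : size s = #|{: edge D}| by rewrite -cardE.
have le_f := fcard_porbits permE'; move: euler le_card; rewrite /planar size_s.
set n := #|porbits _| in le_f *; set F := fcard _ _ in le_f *.
set m := #|l @: _| in card1 *; set E := #|{: edge D}|; set V := #|_| => euler le_card.
(* The general bound is one inequality; planarity, with at most one label and at least as many
   curves as faces, gives the other. *)
have eq_card : (n + V = 2 * m + E)%N by lia.
move=> /(_ eq_card) sph.
have weight1 h : h != (e, true) -> boundary_weight s h = 1.
  case: h => p []; rewrite /boundary_weight in_s //= xpair_eqE andbT => pe.
  by rewrite glued // mulVg.
(* Every other face has only trivial weights, so a constant function shows it flat. *)
have [f fE] : flat (boundary_perm s) (boundary_weight s) (e, true).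
  apply: sph => u _ ue; exists (fun=> 1) => v vu.
  rewrite weight1 ?mulg1 //.
  by apply: contraNneq ue => <-; rewrite porbit_sym.
(* Around this face only the step leaving [(e, true)] may have a nontrivial weight; closing up
   forces it to be 1. *)
have : f (boundary_perm s (e, true)) = f (e, true).
  by apply: porbit_const => u ue nue; rewrite fE // weight1 // mul1g.
rewrite fE ?porbit_id // => /(canRL (mulgK _)); rewrite mulgV.
by rewrite /boundary_weight in_s /= => /mulg1_eq; rewrite invgK.
Qed.
End Diagram.

(** * Knot groups, colourings and representations *)

Section Representations.
Local Open Scope group_scope.
Local Open Scope quotient_scope.
Local Notation next := Defs.next.

Lemma multiplicative1 (G H : groupType) (f : {multiplicative G -> H}) : f 1 = 1.
Proof. by apply: (mulgI (f 1)); rewrite -gmulfM !mulg1. Qed.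

Lemma multiplicativeV (G H : groupType) (f : {multiplicative G -> H}) x :
  f x^-1 = (f x)^-1.
Proof. by apply/esym/mulg1_eq; rewrite -gmulfM mulgV multiplicative1. Qed.

(** Von Dyck's theorem: evaluation of words respects the congruence, by induction on its
    derivations. *)
Lemma presented_hom (X : choiceType) (rels : word X -> word X -> Prop)
    (G : groupType) (F : X -> G)
    (ev := fun w : word X => \prod_(a <- w) (if a.2 then (F a.1)^-1 else F a.1)) :
  (forall u v, rels u v -> ev u = ev v) ->
  exists rho : {multiplicative presented_group rels -> G},
    forall x, rho (pres_gen rels x) = F x.
Proof.
move=> evr.
have ev_eq u v : pres_eq rels u v -> ev u = ev v.
  elim=> {u v} [u v /evr //|x b|u u' v v' _ IHu _ IHv|//|//|u v w _ -> //].
    by rewrite /ev big_cons big_seq1 big_nil; case: b; rewrite /= ?mulgV ?mulVg.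
  by rewrite /ev !big_cat /= -!/(ev _) IHu IHv.
pose f (g : presented_group rels) : G := ev (repr g).
have fM : {morph f : x y / x * y}.
  by move=> g h; rewrite /f (ev_eq _ _ (pres_repr _ _)) /ev big_cat.
pose m := isMultiplicative.Build _ _ f fM.
pose rho : {multiplicative presented_group rels -> G} := HB.pack f m.
exists rho => x.
by rewrite [rho _](ev_eq _ _ (pres_repr _ _)) /ev big_seq1.
Qed.

Lemma presented_hom_ext (X : choiceType) (rels : word X -> word X -> Prop)
    (G : groupType) (f f' : {multiplicative presented_group rels -> G}) :
  (forall x, f (pres_gen rels x) = f' (pres_gen rels x)) -> f =1 f'.
Proof.
move=> ff' g; rewrite -[g]reprK; elim: (repr g) => [|[x b] w IH].
  have -> : \pi_(presented_group rels) [::] = 1 by [].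
  by rewrite !multiplicative1.
have -> : \pi_(presented_group rels) ((x, b) :: w) =
    \pi_(presented_group rels) [:: (x, b)] * \pi_(presented_group rels) w.
  by rewrite -cat1s -pres_piM.
rewrite !gmulfM IH; congr (_ * _).
case: b; last exact: ff'.
have -> : \pi_(presented_group rels) [:: (x, true)] = (pres_gen rels x)^-1.
  by symmetry; apply: pres_piV.
by rewrite !multiplicativeV ff'.
Qed.

Section Meridians.
Variable D : gauss_diagram.

Lemma arc_of_over (c : crossing D) :
  arc_of ((next D)^-1 (c, true)) = arc_of (c, true).
Proof.
apply/eqP; rewrite eqmodE; apply: connect1.
by rewrite /arc_adj permKV eqxx.
Qed.

Lemma meridian_colouring :
  wirtinger_colouring (D := D) (fun p => meridian (arc_of ((next D)^-1 p)))
    (fun p => meridian (arc_of p)).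
Proof.
split=> c; first by rewrite arc_of_over.
have : meridian (Defs.left_arc c) =
    meridian (over_arc c) * meridian (Defs.right_arc c) * (meridian (over_arc c))^-1.
  pose pi w : knot_group D := \pi_(presented_group (@wirtinger D)) w.
  have piM u v : pi u * pi v = pi (u ++ v) by apply: pres_piM.
  have piV a : (meridian a)^-1 = pi [:: (a, true)] by apply: pres_piV.
  rewrite piV -![meridian _]/(pi [:: (_, false)]) !piM.
  by apply/eqP/pres_piP/PresRel; exists c.
by rewrite /Defs.left_arc /Defs.right_arc; case: (positive c).
Qed.

(** Agreement across over-passages makes [k] constant on arcs; the conditions at under-passages are
    then the Wirtinger relations. *)
Lemma colouring_hom (G : groupType) (k : edge D -> G) :
  wirtinger_colouring (fun p => k ((next D)^-1 p)) k ->
  exists rho : {multiplicative knot_group D -> G},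
    forall e, rho (meridian (arc_of e)) = k e.
Proof.
move=> [over under].
have k_arc e : k (repr (arc_of e)) = k e.
  have : same_arc (repr (arc_of e)) e by rewrite -eqmodE reprK.
  have adj e' f : f = next D e' -> f.2 -> k f = k e'.
    by case: f => c b /= fE b1; move: fE; rewrite b1 => fE; rewrite -over fE permK.
  case/connectP => p; elim: p (repr _) => [|f p IH] e' /=; first by move=> _ ->.
  by move=> /andP[/orP[]/andP[/eqP/adj H /H E] /IH{}IH /IH <-].
have [rho rhoE] : exists rho : {multiplicative knot_group D -> G},
    forall a, rho (meridian a) = k (repr a).
  apply: presented_hom => _ _ [c [-> ->]].
  rewrite big_seq1 !big_cons big_nil /= mulg1 mulgA.
  move: (under c); rewrite /Defs.left_arc /Defs.right_arc /over_arc !k_arc.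
  by case: (positive c).
by exists rho => e; rewrite rhoE.
Qed.
End Meridians.

Section ConnectedSum.
Variables (D1 D2 : gauss_diagram) (e1 : edge D1) (e2 : edge D2).
Local Notation D := (connected_sum e1 e2).

Let inl1 (p : passage D1) : passage D := csum_inl D2 p.
Let inr2 (p : passage D2) : passage D := csum_inr D1 p.

Lemma csum_prev_inl p : (next D)^-1 (inl1 p) =
  if (next D1)^-1 p == e1 then inr2 e2 else inl1 ((next D1)^-1 p).
Proof.
apply: (canLR (permK _)); rewrite permE; case: ifP => /= H.
  by rewrite -surjective_pairing eqxx -(eqP H) permKV.
by rewrite -surjective_pairing H permKV.
Qed.

Lemma csum_prev_inr p : (next D)^-1 (inr2 p) =
  if (next D2)^-1 p == e2 then inl1 e1 else inr2 ((next D2)^-1 p).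
Proof.
apply: (canLR (permK _)); rewrite permE; case: ifP => /= H.
  by rewrite -surjective_pairing eqxx -(eqP H) permKV.
by rewrite -surjective_pairing H permKV.
Qed.

Lemma connecting_meridian : knot_diagram D1 ->
  meridian (arc_of (inr2 e2)) = meridian (arc_of (inl1 e1)).
Proof.
move=> hD1; have [over under] := meridian_colouring D.
(* This colours [D1] cut at [e1]: the edge leaving [e1] is [inl1 e1], while the edge entering
   [next D1 e1] is [inr2 e2]. All other edges of [D1] are uncut. *)
pose kin p := meridian (arc_of ((next D)^-1 (inl1 p))).
pose kout p := meridian (arc_of (inl1 p)).
have col : wirtinger_colouring kin kout.
  by split=> c; [apply: (over (inl c)) | apply: (under (inl c))].
have := long_knot_colour (e := e1) col hD1.
rewrite /kin /kout csum_prev_inl permK eqxx; apply => p pe.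
by rewrite csum_prev_inl permK (negPf pe).
Qed.

Hypothesis hD1 : knot_diagram D1.

Lemma csum_inl_colouring :
  wirtinger_colouring (fun p => meridian (arc_of (inl1 ((next D1)^-1 p))))
    (fun p => meridian (arc_of (inl1 p))).
Proof.
(* The incoming edges in [D1] and in the sum differ only after [e1], where the connecting meridians
   agree. *)
have kinE p : meridian (arc_of (inl1 ((next D1)^-1 p))) =
    meridian (arc_of ((next D)^-1 (inl1 p))).
  by rewrite csum_prev_inl; case: eqP => // ->; rewrite connecting_meridian.
have [over under] := meridian_colouring D.
by split=> c; rewrite kinE; [apply: (over (inl c)) | apply: (under (inl c))].
Qed.

Lemma csum_inr_colouring :
  wirtinger_colouring (fun p => meridian (arc_of (inr2 ((next D2)^-1 p))))
    (fun p => meridian (arc_of (inr2 p))).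
Proof.
have kinE p : meridian (arc_of (inr2 ((next D2)^-1 p))) =
    meridian (arc_of ((next D)^-1 (inr2 p))).
  by rewrite csum_prev_inr; case: eqP => // ->; rewrite connecting_meridian.
have [over under] := meridian_colouring D.
by split=> c; rewrite kinE; [apply: (over (inr c)) | apply: (under (inr c))].
Qed.

Lemma csum_inl_hom : exists iota : {multiplicative knot_group D1 -> knot_group D},
  forall e, iota (meridian (arc_of e)) = meridian (arc_of (inl1 e)).
Proof. exact: colouring_hom csum_inl_colouring. Qed.

Lemma csum_inr_hom : exists iota : {multiplicative knot_group D2 -> knot_group D},
  forall e, iota (meridian (arc_of e)) = meridian (arc_of (inr2 e)).
Proof. exact: colouring_hom csum_inr_colouring. Qed.
End ConnectedSum.

Section Conjugation.
Variables (D : gauss_diagram) (F : fieldType).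
Implicit Types rho : representation D F.

Lemma conj_rep_refl rho : conj_rep rho rho.
Proof. by exists 1 => x; rewrite mul1g invg1 mulg1. Qed.

Lemma conj_rep_sym rho rho' : conj_rep rho rho' -> conj_rep rho' rho.
Proof. by case=> g E; exists g^-1 => x; rewrite E invgK !mulgA mulVg mul1g mulgVK. Qed.

Lemma conj_rep_trans rho' rho rho'' :
  conj_rep rho rho' -> conj_rep rho' rho'' -> conj_rep rho rho''.
Proof.
by move=> [g E] [h E']; exists (h * g) => x; rewrite E' E invgM !mulgA.
Qed.

Lemma conj_rep_meridian rho rho' (g : PSL2 F) :
  (forall e, rho' (meridian (arc_of e)) = g * rho (meridian (arc_of e)) * g^-1) ->
  conj_rep rho rho'.
Proof.
move=> E; pose f x := g * rho x * g^-1.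
have fM : {morph f : x y / x * y}.
  by move=> x y; rewrite /f gmulfM !mulgA mulgVK.
pose m := isMultiplicative.Build _ _ f fM.
pose rhog : representation D F := HB.pack f m.
exists g => x; apply: (presented_hom_ext (f' := rhog)) => a.
by rewrite -[a]reprK; apply: E.
Qed.
End Conjugation.
End Representations.

Theorem propositionA1 (R : realType) (D1 D2 : gauss_diagram)
    (hD1 : knot_diagram D1) (hD2 : knot_diagram D2)
    (e1 : edge D1) (e2 : edge D2)
    (rho : representation (connected_sum e1 e2) (R[i]))
    (hrho : boundary_parabolic rho) :
  exists (rho1 : representation D1 (R[i])) (rho2 : representation D2 (R[i])),
    [/\ boundary_parabolic rho1, boundary_parabolic rho2,
        decomposes rho rho1 rho2
      & forall (rho1' : representation D1 (R[i]))
               (rho2' : representation D2 (R[i])),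
          boundary_parabolic rho1' -> boundary_parabolic rho2' ->
          decomposes rho rho1' rho2' ->
          conj_rep rho1 rho1' /\ conj_rep rho2 rho2'].
Proof.
have [i1 i1E] := csum_inl_hom e1 e2 hD1.
have [i2 i2E] := csum_inr_hom e1 e2 hD1.
pose rho1 : representation D1 (R[i]) := rho \o i1.
pose rho2 : representation D2 (R[i]) := rho \o i2.
have rho1E e : rho1 (meridian (arc_of e)) =
    rho (meridian (@arc_of (connected_sum e1 e2) (csum_inl D2 e))).
  by rewrite /rho1 /= i1E.
have rho2E e : rho2 (meridian (arc_of e)) =
    rho (meridian (@arc_of (connected_sum e1 e2) (csum_inr D1 e))).
  by rewrite /rho2 /= i2E.
exists rho1, rho2; split.
- by move=> a; rewrite -[a]reprK [rho1 _]rho1E; apply: hrho.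
- by move=> a; rewrite -[a]reprK [rho2 _]rho2E; apply: hrho.
- exists rho; first exact: conj_rep_refl.
  exists rho1, rho2; split=> //; try exact: conj_rep_refl.
  by rewrite rho1E rho2E connecting_meridian.
(* The colours of [rho'] determine [s1] and [s2], so the same [g] conjugates [rho1] to [s1] and
   [rho2] to [s2]. *)
move=> rho1' rho2' _ _ [rho' [g gE] [s1 [s2 [c1 c2 _ E1 E2]]]]; split.
  apply: conj_rep_trans (conj_rep_sym c1).
  by apply: (conj_rep_meridian (g := g)) => e; rewrite -E1 gE rho1E.
apply: conj_rep_trans (conj_rep_sym c2).
by apply: (conj_rep_meridian (g := g)) => e; rewrite -E2 gE rho2E.
Qed.
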